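(* Let $N_L,N_R$ be integers with $N_R-N_L\ge3$ and let $u^n=u^n(x,j)$ be functions of $(x,j)\in\mathbb R\times\mathbb Z$. The chain $$u^n_x-u^n_{1,x}=e^{u^{n-1}-u^n_1}-e^{u^n-u^{n+1}_1}$$ reduced to the finite interval $N_L\le n\le N_R$ with the boundary conditions $$u^{N_L-1}=u^{N_L}_1+u^{N_L+1}_1-u^{N_L+2}_2,\qquad u^{N_R+1}=u^{N_R}_{-1}+u^{N_R-1}_{-1}-u^{N_R-2}_{-2}$$ is the compatibility condition of the following overdetermined system of linear equations: (i) equations for functions $A,B,\hat A,\hat B$ of $(x,j)$: $$\begin{aligned}&A_1=A,\quad A_x+\left(u^{N_L}_x+u^{N_L+1}_{1,x}+e^{u^{N_L}-u^{N_L+1}_1}\right)A=0,\\ &B_1=B,\quad B_x=\left(u^{N_L}_x+u^{N_L+1}_x+e^{u^{N_L+1}-u^{N_L+2}_1}\right)B,\\ &\hat A_1=\hat A,\quad \hat A_x=\left(u^{N_R}_x+u^{N_R-1}_{-1,x}+e^{u^{N_R-1}_{-1}-u^{N_R}}\right)\hat A,\\ &\hat B_1=\hat B,\quad \hat B_x=-\left(u^{N_R}_x+u^{N_R-1}_x+e^{u^{N_R-2}_{-1}-u^{N_R-1}}\right)\hat B;\end{aligned}$$ (ii) equations for $\phi^n,\rho^n$, $N_L+1\le n\le N_R-1$: $$\begin{aligned} \phi^{N_L+1}_1&=Ae^{u^{N_L}-u^{N_L+1}_1}\rho^{N_L+1}+\phi^{N_L+1},& \phi^{N_L+1}_x&=\phi^{N_L+2}-u^{N_L+1}_x\phi^{N_L+1},\\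 \rho^{N_L+1}_{-1}&=e^{u^{N_L+1}-u^{N_L+2}_1}\rho^{N_L+2}+\rho^{N_L+1},& \rho^{N_L+1}_x&=-B\phi^{N_L+1}+\left(u^{N_L+1}_{1,x}+e^{u^{N_L}-u^{N_L+1}_1}\right)\rho^{N_L+1},\end{aligned}$$ for $N_L+2\le n\le N_R-2$ $$\begin{aligned}\phi^n_1&=e^{u^{n-1}-u^n_1}\phi^{n-1}+\phi^n,&\phi^n_x&=\phi^{n+1}-u^n_x\phi^n,\\ \rho^n_{-1}&=e^{u^n-u^{n+1}_1}\rho^{n+1}+\rho^n,&\rho^n_x&=-\rho^{n-1}+u^n_{1,x}\rho^n,\end{aligned}$$ and $$\begin{aligned}\phi^{N_R-1}_1&=e^{u^{N_R-2}-u^{N_R-1}_1}\phi^{N_R-2}+\phi^{N_R-1},&\phi^{N_R-1}_x&=\hat B\rho^{N_R-1}-\left(u^{N_R-1}_x+e^{u^{N_R-3}_{-1}-u^{N_R-2}}\right)\phi^{N_R-1},\\ \rho^{N_R-1}_{-1}&=e^{u^{N_R-1}-u^{N_R}_1}\hat A\phi^{N_R-1}+\rho^{N_R-1},&\rho^{N_R-1}_x&=-\rho^{N_R-2}+u^{N_R-1}_{1,x}\rho^{N_R-1}.\end{aligned}$$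
   Context: For a function $f=f(x,j)$ of a continuous variable $x$ and a discrete variable $j\in\mathbb Z$, write $f_k=f(x,j+k)$ (also for negative $k$), $f_x=\partial_xf$, $f_{k,x}=\partial_x f(x,j+k)$. The functions $A,B,\hat A,\hat B$ are determined by (i) up to constant factors and are chosen so that $AB=-1$ and $\hat A\hat B=-1$. Compatibility means that differentiation in $x$ and the shift in $j$ commute on all the unknowns $A,B,\hat A,\hat B,\phi^n,\rho^n$. In the reduced chain, $u^{N_L-1}$ and $u^{N_R+1}$ in the equations with $n=N_L$ and $n=N_R$ are eliminated using the boundary conditions, so that the first and last equations read $$u^{N_L}_x-u^{N_L}_{1,x}=e^{u^{N_L+1}_1-u^{N_L+2}_2}-e^{u^{N_L}-u^{N_L+1}_1},\qquad u^{N_R}_x-u^{N_R}_{1,x}=e^{u^{N_R-1}-u^{N_R}_1}-e^{u^{N_R-2}_{-1}-u^{N_R-1}}.$$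
   Formalization: In the equation for $\phi^{N_R-1}_x$ the printed exponential $e^{u^{N_R-3}_{-1}-u^{N_R-2}}$ is replaced by $e^{u^{N_R-1}-u^{N_R}_1}$; with the printed exponent the system is not compatible on all solutions of the reduced chain. *)

(* Defs.v *)
From Stdlib Require Import Reals ZArith Lia Lra.
From Coquelicot Require Import Coquelicot.

Open Scope R_scope.

(* [u n x j] is u^n(x,j); the shift f_k of f is f(x,j+k). *)
Definition lattice_field := Z -> R -> Z -> R.

Definition ddx (u : lattice_field) (n : Z) (x : R) (j : Z) : R :=
  Derive (fun y => u n y j) x.

Definition chain_at (u : lattice_field) (n : Z) (x : R) (j : Z) : Prop :=
  ddx u n x j - ddx u n x (j + 1)
  = exp (u (n - 1)%Z x j - u n x (j + 1)%Z)
    - exp (u n x j - u (n + 1)%Z x (j + 1)%Z).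

(* Only the values of [u] for NL <= n <= NR are used; the boundary conditions
   supply u^{NL-1} and u^{NR+1}. *)
Definition with_boundary (NL NR : Z) (u : lattice_field) : lattice_field :=
  fun n x j =>
    if (n =? NL - 1)%Z then
      u NL x (j + 1)%Z + u (NL + 1)%Z x (j + 1)%Z - u (NL + 2)%Z x (j + 2)%Z
    else if (n =? NR + 1)%Z then
      u NR x (j - 1)%Z + u (NR - 1)%Z x (j - 1)%Z - u (NR - 2)%Z x (j - 2)%Z
    else u n x j.

Definition reduced_chain (NL NR : Z) (u : lattice_field) : Prop :=
  forall (n : Z) (x : R) (j : Z), (NL <= n <= NR)%Z ->
    chain_at (with_boundary NL NR u) n x j.

(* Values at one point (x,j) of the unknowns A, B, \hat A, \hat B, phi^n, rho^n.
   Only phi^n and rho^n with NL+1 <= n <= NR-1 are meaningful. *)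
Record state := State {
  fA : R; fB : R; fAh : R; fBh : R; fphi : Z -> R; frho : Z -> R }.

(* [x_equations NL NR u x j s v]: the x-derivatives of the unknowns at (x,j)
   prescribed by the linear system are [v] when their values there are [s]. *)
Record x_equations (NL NR : Z) (u : lattice_field) (x : R) (j : Z)
    (s v : state) : Prop := {
  xeq_A : fA v
    + (ddx u NL x j + ddx u (NL + 1) x (j + 1)
       + exp (u NL x j - u (NL + 1)%Z x (j + 1)%Z)) * fA s = 0;
  xeq_B : fB v
    = (ddx u NL x j + ddx u (NL + 1) x j
       + exp (u (NL + 1)%Z x j - u (NL + 2)%Z x (j + 1)%Z)) * fB s;
  xeq_Ah : fAh v
    = (ddx u NR x j + ddx u (NR - 1) x (j - 1)
       + exp (u (NR - 1)%Z x (j - 1)%Z - u NR x j)) * fAh s;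
  xeq_Bh : fBh v
    = - (ddx u NR x j + ddx u (NR - 1) x j
         + exp (u (NR - 2)%Z x (j - 1)%Z - u (NR - 1)%Z x j)) * fBh s;
  xeq_phi_left : fphi v (NL + 1)%Z
    = fphi s (NL + 2)%Z - ddx u (NL + 1) x j * fphi s (NL + 1)%Z;
  xeq_rho_left : frho v (NL + 1)%Z
    = - fB s * fphi s (NL + 1)%Z
      + (ddx u (NL + 1) x (j + 1)
         + exp (u NL x j - u (NL + 1)%Z x (j + 1)%Z)) * frho s (NL + 1)%Z;
  xeq_phi : forall n, (NL + 2 <= n <= NR - 2)%Z ->
    fphi v n = fphi s (n + 1)%Z - ddx u n x j * fphi s n;
  xeq_rho : forall n, (NL + 2 <= n <= NR - 2)%Z ->
    frho v n = - frho s (n - 1)%Z + ddx u n x (j + 1) * frho s n;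
  (* The exponent is u^{NR-1} - u^{NR}_1, the mirror image of the one in
     [xeq_rho_left]. The exponent u^{NR-3}_{-1} - u^{NR-2} that appears in print
     is a misprint: with it the system is not compatible on all solutions of
     the reduced chain. *)
  xeq_phi_right : fphi v (NR - 1)%Z
    = fBh s * frho s (NR - 1)%Z
      - (ddx u (NR - 1) x j
         + exp (u (NR - 1)%Z x j - u NR x (j + 1)%Z)) * fphi s (NR - 1)%Z;
  xeq_rho_right : frho v (NR - 1)%Z
    = - frho s (NR - 2)%Z + ddx u (NR - 1) x (j + 1) * frho s (NR - 1)%Z }.

(* [shift_equations NL NR u x j s s1]: the equations of the linear system
   between the values [s] of the unknowns at (x,j) and [s1] at (x,j+1). The
   equations for rho^n_{-1} are taken at the point (x,j+1). *)
Record shift_equations (NL NR : Z) (u : lattice_field) (x : R) (j : Z)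
    (s s1 : state) : Prop := {
  seq_A : fA s1 = fA s;
  seq_B : fB s1 = fB s;
  seq_Ah : fAh s1 = fAh s;
  seq_Bh : fBh s1 = fBh s;
  seq_phi_left : fphi s1 (NL + 1)%Z
    = fA s * exp (u NL x j - u (NL + 1)%Z x (j + 1)%Z) * frho s (NL + 1)%Z
      + fphi s (NL + 1)%Z;
  seq_rho_left : frho s (NL + 1)%Z
    = exp (u (NL + 1)%Z x (j + 1)%Z - u (NL + 2)%Z x (j + 2)%Z)
        * frho s1 (NL + 2)%Z
      + frho s1 (NL + 1)%Z;
  seq_phi : forall n, (NL + 2 <= n <= NR - 2)%Z ->
    fphi s1 n
    = exp (u (n - 1)%Z x j - u n x (j + 1)%Z) * fphi s (n - 1)%Z + fphi s n;
  seq_rho : forall n, (NL + 2 <= n <= NR - 2)%Z ->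
    frho s n
    = exp (u n x (j + 1)%Z - u (n + 1)%Z x (j + 2)%Z) * frho s1 (n + 1)%Z
      + frho s1 n;
  seq_phi_right : fphi s1 (NR - 1)%Z
    = exp (u (NR - 2)%Z x j - u (NR - 1)%Z x (j + 1)%Z) * fphi s (NR - 2)%Z
      + fphi s (NR - 1)%Z;
  seq_rho_right : frho s (NR - 1)%Z
    = exp (u (NR - 1)%Z x (j + 1)%Z - u NR x (j + 2)%Z)
        * fAh s1 * fphi s1 (NR - 1)%Z
      + frho s1 (NR - 1)%Z }.

Definition state_line (s v : state) (t : R) : state :=
  State (fA s + t * fA v) (fB s + t * fB v)
        (fAh s + t * fAh v) (fBh s + t * fBh v)
        (fun n => fphi s n + t * fphi v n)
        (fun n => frho s n + t * frho v n).

(* Expressions in x, j and the unknowns at (x,j). *)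
Definition observable := R -> Z -> state -> R.

(* For [V] sending the values of the unknowns to their x-derivatives and [S]
   sending them to their values at j+1, the total x-derivative and the shift
   acting on observables. *)
Definition along_flow (V : R -> Z -> state -> state) (f : observable)
    (x : R) (j : Z) (s : state) (t : R) : R :=
  f (x + t) j (state_line s (V x j s) t).

Definition total_Dx (V : R -> Z -> state -> state) (f : observable)
    : observable :=
  fun x j s => Derive (along_flow V f x j s) 0.

Definition total_shift (S : R -> Z -> state -> state) (f : observable)
    : observable :=
  fun x j s => f x (j + 1)%Z (S x j s).

Definition commute_on (V S : R -> Z -> state -> state) (q : state -> R)
    : Prop :=
  let f : observable := fun _ _ s => q s in
  forall (x : R) (j : Z) (s : state),
    fA s * fB s = -1 -> fAh s * fBh s = -1 ->
    ex_derive (along_flow V (total_shift S f) x j s) 0 /\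
    total_Dx V (total_shift S f) x j s = total_shift S (total_Dx V f) x j s.

(* [V] and [S] exist, and are unique up to the meaningless components of the
   states: see [x_equations_solvable] and the lemmas that follow it. *)
Definition compatible (NL NR : Z) (u : lattice_field) : Prop :=
  forall V S : R -> Z -> state -> state,
    (forall x j s, x_equations NL NR u x j s (V x j s)) ->
    (forall x j s, shift_equations NL NR u x j s (S x j s)) ->
    commute_on V S fA /\ commute_on V S fB /\
    commute_on V S fAh /\ commute_on V S fBh /\
    forall n : Z, (NL + 1 <= n <= NR - 1)%Z ->
      commute_on V S (fun s => fphi s n) /\
      commute_on V S (fun s => frho s n).

Definition same_state (NL NR : Z) (s s' : state) : Prop :=
  fA s = fA s' /\ fB s = fB s' /\ fAh s = fAh s' /\ fBh s = fBh s' /\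
  forall n : Z, (NL + 1 <= n <= NR - 1)%Z ->
    fphi s n = fphi s' n /\ frho s n = frho s' n.

Lemma x_equations_solvable NL NR u : (3 <= NR - NL)%Z ->
  exists V, forall x j s, x_equations NL NR u x j s (V x j s).
Proof.
intros h.
exists (fun x j s => State
  (- ((ddx u NL x j + ddx u (NL + 1) x (j + 1)
       + exp (u NL x j - u (NL + 1)%Z x (j + 1)%Z)) * fA s))
  ((ddx u NL x j + ddx u (NL + 1) x j
       + exp (u (NL + 1)%Z x j - u (NL + 2)%Z x (j + 1)%Z)) * fB s)
  ((ddx u NR x j + ddx u (NR - 1) x (j - 1)
       + exp (u (NR - 1)%Z x (j - 1)%Z - u NR x j)) * fAh s)
  (- (ddx u NR x j + ddx u (NR - 1) x j
         + exp (u (NR - 2)%Z x (j - 1)%Z - u (NR - 1)%Z x j)) * fBh s)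
  (fun n => if (n =? NR - 1)%Z then
      fBh s * frho s (NR - 1)%Z
      - (ddx u (NR - 1) x j
         + exp (u (NR - 1)%Z x j - u NR x (j + 1)%Z)) * fphi s (NR - 1)%Z
    else fphi s (n + 1)%Z - ddx u n x j * fphi s n)
  (fun n => if (n =? NL + 1)%Z then
      - fB s * fphi s (NL + 1)%Z
      + (ddx u (NL + 1) x (j + 1)
         + exp (u NL x j - u (NL + 1)%Z x (j + 1)%Z)) * frho s (NL + 1)%Z
    else - frho s (n - 1)%Z + ddx u n x (j + 1) * frho s n)).
intros x j s; split; cbn; try reflexivity.
- ring.
- destruct (Z.eqb_spec (NL + 1) (NR - 1)); [lia|].
  now replace (NL + 1 + 1)%Z with (NL + 2)%Z by lia.
- now rewrite Z.eqb_refl.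
- intros n hn; destruct (Z.eqb_spec n (NR - 1)); [lia|reflexivity].
- intros n hn; destruct (Z.eqb_spec n (NL + 1)); [lia|reflexivity].
- now rewrite Z.eqb_refl.
- destruct (Z.eqb_spec (NR - 1) (NL + 1)); [lia|].
  now replace (NR - 1 - 1)%Z with (NR - 2)%Z by lia.
Qed.

Lemma x_equations_unique NL NR u x j s v v' :
  x_equations NL NR u x j s v -> x_equations NL NR u x j s v' ->
  same_state NL NR v v'.
Proof.
intros [a1 a2 a3 a4 a5 a6 a7 a8 a9 a10] [b1 b2 b3 b4 b5 b6 b7 b8 b9 b10].
repeat split; try congruence; try lra;
  (destruct (Z.eq_dec n (NL + 1)) as [->|]; [congruence|];
   destruct (Z.eq_dec n (NR - 1)) as [->|]; [congruence|];
   rewrite ?a7, ?b7, ?a8, ?b8 by lia; reflexivity).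
Qed.

Lemma shift_equations_solvable NL NR u : (3 <= NR - NL)%Z ->
  exists S, forall x j s, shift_equations NL NR u x j s (S x j s).
Proof.
intros h.
pose (p := fun x j s n => if (n =? NL + 1)%Z then
    fA s * exp (u NL x j - u (NL + 1)%Z x (j + 1)%Z) * frho s (NL + 1)%Z
      + fphi s (NL + 1)%Z
  else exp (u (n - 1)%Z x j - u n x (j + 1)%Z) * fphi s (n - 1)%Z + fphi s n).
(* rho^{NR-1-k}_1, by back substitution *)
pose (r := fun x j s => fix r (k : nat) : R :=
  match k with
  | O => frho s (NR - 1)%Z
         - exp (u (NR - 1)%Z x (j + 1)%Z - u NR x (j + 2)%Z)
           * fAh s * p x j s (NR - 1)%Z
  | Datatypes.S k' =>
      let n := (NR - 1 - Z.of_nat k)%Z in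
      frho s n - exp (u n x (j + 1)%Z - u (n + 1)%Z x (j + 2)%Z) * r k'
  end).
assert (hr : forall x j s n, (n <= NR - 2)%Z ->
  frho s n = exp (u n x (j + 1)%Z - u (n + 1)%Z x (j + 2)%Z)
             * r x j s (Z.to_nat (NR - 1 - (n + 1)))
           + r x j s (Z.to_nat (NR - 1 - n))).
{ intros x j s n hn.
  replace (Z.to_nat (NR - 1 - n))
    with (Datatypes.S (Z.to_nat (NR - 1 - (n + 1)))) by lia.
  set (k := Z.to_nat (NR - 1 - (n + 1))).
  change (r x j s (Datatypes.S k)) with
    (let m := (NR - 1 - Z.of_nat (Datatypes.S k))%Z in
     frho s m - exp (u m x (j + 1)%Z - u (m + 1)%Z x (j + 2)%Z) * r x j s k).
  replace (NR - 1 - Z.of_nat (Datatypes.S k))%Z with n by lia.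
  cbv zeta; ring. }
exists (fun x j s => State (fA s) (fB s) (fAh s) (fBh s)
  (p x j s) (fun n => r x j s (Z.to_nat (NR - 1 - n)))).
intros x j s; split; cbn [fA fB fAh fBh fphi frho]; try reflexivity.
- unfold p; now rewrite Z.eqb_refl.
- rewrite (hr x j s (NL + 1)%Z) by lia.
  now replace (NL + 1 + 1)%Z with (NL + 2)%Z by lia.
- intros n hn; unfold p; destruct (Z.eqb_spec n (NL + 1)); [lia|reflexivity].
- intros n hn; apply hr; lia.
- unfold p; destruct (Z.eqb_spec (NR - 1) (NL + 1)); [lia|].
  now replace (NR - 1 - 1)%Z with (NR - 2)%Z by lia.
- replace (Z.to_nat (NR - 1 - (NR - 1))) with O by lia.
  cbn; ring.
Qed.

Lemma shift_equations_unique NL NR u x j s s1 s1' :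
  shift_equations NL NR u x j s s1 -> shift_equations NL NR u x j s s1' ->
  same_state NL NR s1 s1'.
Proof.
intros [a1 a2 a3 a4 a5 a6 a7 a8 a9 a10] [b1 b2 b3 b4 b5 b6 b7 b8 b9 b10].
assert (hp : forall n, (NL + 1 <= n <= NR - 1)%Z -> fphi s1 n = fphi s1' n).
{ intros n hn.
  destruct (Z.eq_dec n (NL + 1)) as [->|]; [congruence|].
  destruct (Z.eq_dec n (NR - 1)) as [->|]; [congruence|].
  rewrite a7, b7 by lia; reflexivity. }
assert (hr : forall k n, n = (NR - 1 - Z.of_nat k)%Z ->
  (NL + 1 <= n)%Z -> frho s1 n = frho s1' n).
{ induction k as [|k IH]; intros n hk hn.
  - replace n with (NR - 1)%Z by lia.
    rewrite (hp (NR - 1)%Z), a3, <- b3 in a10 by lia; lra.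
  - destruct (Z.eq_dec n (NL + 1)) as [e|].
    + rewrite (IH (NL + 2)%Z) in a6 by lia; rewrite e; lra.
    + specialize (a8 n ltac:(lia)); specialize (b8 n ltac:(lia)).
      rewrite (IH (n + 1)%Z) in a8 by lia; lra. }
repeat split; try congruence; auto.
apply (hr (Z.to_nat (NR - 1 - n))); lia.
Qed.

(* Main.v *)
(* On the coordinates of a state the x-flow and the shift are given explicitly,
   so the failure of commutation can be computed: on phi^n it is the defect of
   the n-th chain equation times phi^n, and on A, \hat A it is the failure of
   the coefficients of A_x, \hat A_x to be invariant under the shift. Given the
   chain equations for NL < n < NR, those two invariances amount to the boundary
   equations. Commutation on B, \hat B and the rho^n (by descending induction on
   n) then follows. The conditions A B = -1 and \hat A \hat B = -1 are what
   makes the two ends phi^{NL+1} and phi^{NR-1} behave like the interior. *)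

Require Import Defs.
From Stdlib Require Import Reals ZArith Lia Lra FunctionalExtensionality.
From Coquelicot Require Import Coquelicot.
Open Scope R_scope.

(** * Index normalisation and rules of differentiation *)

Lemma Z_succ_succ n : (n + 1 + 1 = n + 2)%Z. Proof. lia. Qed.
Lemma Z_succ_pred n : (n + 1 - 1 = n)%Z. Proof. lia. Qed.
Lemma Z_pred_succ n : (n - 1 + 1 = n)%Z. Proof. lia. Qed.
Lemma Z_pred_pred n : (n - 1 - 1 = n - 2)%Z. Proof. lia. Qed.
Lemma Z_sub2_succ n : (n - 2 + 1 = n - 1)%Z. Proof. lia. Qed.
Lemma Z_add1_sub2 n : (n + 1 - 2 = n - 1)%Z. Proof. lia. Qed.

#[local] Hint Rewrite Z_succ_succ Z_succ_pred Z_pred_succ Z_pred_pred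
 Z_sub2_succ Z_add1_sub2 : index.

Lemma is_derive_Rmult (f g : R -> R) (x df dg : R) :
  is_derive f x df -> is_derive g x dg ->
  is_derive (fun t => f t * g t) x (df * g x + f x * dg).
Proof. intros hf hg; exact (is_derive_mult f g x df dg hf hg Rmult_comm). Qed.

Lemma is_derive_Rplus (f g : R -> R) (x df dg : R) :
  is_derive f x df -> is_derive g x dg ->
  is_derive (fun t => f t + g t) x (df + dg).
Proof. exact (is_derive_plus f g x df dg). Qed.

Lemma is_derive_Rminus (f g : R -> R) (x df dg : R) :
  is_derive f x df -> is_derive g x dg ->
  is_derive (fun t => f t - g t) x (df - dg).
Proof. exact (is_derive_minus f g x df dg). Qed.

Lemma is_derive_line (a b x : R) : is_derive (fun t => a + t * b) x b.
Proof. auto_derive; [exact I | ring]. Qed.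

Lemma is_derive_translate (f : R -> R) (x : R) :
  ex_derive f x -> is_derive (fun t => f (x + t)) 0 (Derive f x).
Proof.
intros hf; evar_last.
- apply (is_derive_comp f (fun t => x + t) 0).
  + rewrite Rplus_0_r; apply Derive_correct, hf.
  + auto_derive; [exact I | reflexivity].
- apply Rmult_1_l.
Qed.

Lemma is_derive_exp_minus (f g : R -> R) (x : R) :
  ex_derive f x -> ex_derive g x ->
  is_derive (fun t => exp (f (x + t) - g (x + t))) 0
    ((Derive f x - Derive g x) * exp (f x - g x)).
Proof.
intros hf hg; evar_last.
- apply (is_derive_comp exp (fun t => f (x + t) - g (x + t)) 0).
  + apply is_derive_exp.
  + apply is_derive_Rminus; apply is_derive_translate; assumption.
- rewrite Rplus_0_r; reflexivity.
Qed.

(** * Commutation on a single coordinate of the state *)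

Lemma state_line_0 s v : state_line s v 0 = s.
Proof.
destruct s; unfold state_line; cbn; f_equal; try ring;
  apply functional_extensionality; intros n; ring.
Qed.

(** Along [state_line] such a [q] is affine in [t], so its total derivative is [q] applied to [V].
    Existence of the derivative and equality of the two orders then merge into one [is_derive]
    statement, with [V] and [S] still abstract. *)
Lemma commute_on_linear V S q :
  (forall s v t, q (state_line s v t) = q s + t * q v) ->
  (commute_on V S q <->
   forall x j s, fA s * fB s = -1 -> fAh s * fBh s = -1 ->
     is_derive (fun t => q (S (x + t) j (state_line s (V x j s) t))) 0
       (q (V x (j + 1)%Z (S x j s)))).
Proof.
intros hq.
assert (h : forall x j s,
  total_shift S (total_Dx V (fun _ _ s => q s)) x j s
  = q (V x (j + 1)%Z (S x j s))).
{ intros x j s; apply is_derive_unique.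
  apply (is_derive_ext (fun t => q (S x j s) + t * q (V x (j + 1)%Z (S x j s)))).
  - intros t; symmetry; apply hq.
  - apply is_derive_line. }
split.
- intros hc x j s hAB hABh; destruct (hc x j s hAB hABh) as [he hd].
  rewrite <- h, <- hd; apply Derive_correct, he.
- intros hc x j s hAB hABh; specialize (hc x j s hAB hABh); split.
  + eexists; exact hc.
  + rewrite h; apply is_derive_unique, hc.
Qed.

(** * The reduced chain as interior equations plus two end equations *)

Definition left_equation (NL : Z) (u : lattice_field) : Prop :=
  forall x j, ddx u NL x j - ddx u NL x (j + 1)
    = exp (u (NL + 1)%Z x (j + 1)%Z - u (NL + 2)%Z x (j + 2)%Z)
      - exp (u NL x j - u (NL + 1)%Z x (j + 1)%Z).

Definition right_equation (NR : Z) (u : lattice_field) : Prop :=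
  forall x j, ddx u NR x j - ddx u NR x (j + 1)
    = exp (u (NR - 1)%Z x j - u NR x (j + 1)%Z)
      - exp (u (NR - 2)%Z x (j - 1)%Z - u (NR - 1)%Z x j).

(** The boundary values turn $u^{N_L-1}-u^{N_L}_1$ into $u^{N_L+1}_1-u^{N_L+2}_2$ and
    $u^{N_R}-u^{N_R+1}_1$ into $u^{N_R-2}_{-1}-u^{N_R-1}$; the interior equations do not see
    them. *)
Lemma reduced_chainE (NL NR : Z) (u : lattice_field) : (NR - NL >= 3)%Z ->
  reduced_chain NL NR u <->
  (forall n x j, (NL + 1 <= n <= NR - 1)%Z -> chain_at u n x j)
  /\ left_equation NL u /\ right_equation NR u.
Proof.
intros hN.
assert (hw : forall n, (NL <= n <= NR)%Z -> with_boundary NL NR u n = u n).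
{ intros n hn; unfold with_boundary.
  destruct (Z.eqb_spec n (NL - 1)), (Z.eqb_spec n (NR + 1)); lia || reflexivity. }
assert (hd : forall n x j, (NL <= n <= NR)%Z ->
  ddx (with_boundary NL NR u) n x j = ddx u n x j).
{ intros n x j hn; unfold ddx; now rewrite hw. }
assert (hL : forall x j, chain_at (with_boundary NL NR u) NL x j <->
  ddx u NL x j - ddx u NL x (j + 1)
    = exp (u (NL + 1)%Z x (j + 1)%Z - u (NL + 2)%Z x (j + 2)%Z)
      - exp (u NL x j - u (NL + 1)%Z x (j + 1)%Z)).
{ intros x j; unfold chain_at.
  rewrite !hd, (hw NL), (hw (NL + 1)%Z) by lia.
  unfold with_boundary; rewrite Z.eqb_refl.
  replace (u NL x (j + 1)%Z + u (NL + 1)%Z x (j + 1)%Z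
           - u (NL + 2)%Z x (j + 2)%Z - u NL x (j + 1)%Z)
    with (u (NL + 1)%Z x (j + 1)%Z - u (NL + 2)%Z x (j + 2)%Z) by ring.
  reflexivity. }
assert (hR : forall x j, chain_at (with_boundary NL NR u) NR x j <->
  ddx u NR x j - ddx u NR x (j + 1)
    = exp (u (NR - 1)%Z x j - u NR x (j + 1)%Z)
      - exp (u (NR - 2)%Z x (j - 1)%Z - u (NR - 1)%Z x j)).
{ intros x j; unfold chain_at.
  rewrite !hd, (hw NR), (hw (NR - 1)%Z) by lia.
  unfold with_boundary; rewrite Z.eqb_refl.
  destruct (Z.eqb_spec (NR + 1) (NL - 1)); [lia |].
  autorewrite with index.
  replace (u NR x j - (u NR x j + u (NR - 1)%Z x j
           - u (NR - 2)%Z x (j - 1)%Z))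
    with (u (NR - 2)%Z x (j - 1)%Z - u (NR - 1)%Z x j) by ring.
  reflexivity. }
assert (hI : forall n x j, (NL + 1 <= n <= NR - 1)%Z ->
  chain_at (with_boundary NL NR u) n x j <-> chain_at u n x j).
{ intros n x j hn; unfold chain_at; rewrite !hd, !hw by lia; reflexivity. }
split.
- intros h; repeat split.
  + intros n x j hn; apply hI, h; lia.
  + intros x j; apply hL, h; lia.
  + intros x j; apply hR, h; lia.
- intros (h & hl & hr) n x j hn.
  destruct (Z.eq_dec n NL) as [-> | ]; [apply hL, hl |].
  destruct (Z.eq_dec n NR) as [-> | ]; [apply hR, hr |].
  apply hI; [| apply h]; lia.
Qed.

Definition A_rate (NL : Z) (u : lattice_field) (x : R) (j : Z) : R :=
  ddx u NL x j + ddx u (NL + 1) x (j + 1)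
  + exp (u NL x j - u (NL + 1)%Z x (j + 1)%Z).

Definition Ah_rate (NR : Z) (u : lattice_field) (x : R) (j : Z) : R :=
  ddx u NR x j + ddx u (NR - 1) x (j - 1)
  + exp (u (NR - 1)%Z x (j - 1)%Z - u NR x j).

(** Modulo the chain equation $n=N_L+1$ at $(x,j+1)$, the increment of [A_rate] from $j$ to $j+1$ is
    the right side minus the left side of the end equation. The mirror lemma uses $n=N_R-1$ at
    $(x,j-1)$. *)
Lemma left_equation_iff NL u :
  (forall x j, chain_at u (NL + 1) x j) ->
  left_equation NL u <-> forall x j, A_rate NL u x (j + 1) = A_rate NL u x j.
Proof.
intros hc; unfold left_equation, A_rate; split; intros h x j;
  specialize (h x j); specialize (hc x (j + 1)%Z); unfold chain_at in hc;
  autorewrite with index in *; lra.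
Qed.

Lemma right_equation_iff NR u :
  (forall x j, chain_at u (NR - 1) x j) ->
  right_equation NR u <-> forall x j, Ah_rate NR u x (j + 1) = Ah_rate NR u x j.
Proof.
intros hc; unfold right_equation, Ah_rate; split; intros h x j;
  specialize (h x j); specialize (hc x (j - 1)%Z); unfold chain_at in hc;
  autorewrite with index in *; lra.
Qed.

(** * The linear system with its end cases merged into the interior ones *)

Section Flow.

Context (NL NR : Z) (u : lattice_field) (hN : (NR - NL >= 3)%Z)
  (hu : forall (n : Z) (x : R) (j : Z), (NL <= n <= NR)%Z ->
          ex_derive (fun y => u n y j) x)
  (V S : R -> Z -> state -> state)
  (hV : forall x j s, x_equations NL NR u x j s (V x j s))
  (hS : forall x j s, shift_equations NL NR u x j s (S x j s)).

(** One end equation of each family has the interior form, so each of these four rules covers one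
    end and leaves a single exceptional one. For $\rho$ the shift is solved as a recursion
    descending from $N_R-1$. *)
Lemma phi_shift x j s n : (NL + 2 <= n <= NR - 1)%Z ->
  fphi (S x j s) n
  = exp (u (n - 1)%Z x j - u n x (j + 1)%Z) * fphi s (n - 1)%Z + fphi s n.
Proof.
intros hn; destruct (Z.eq_dec n (NR - 1)) as [-> | ].
- rewrite (seq_phi_right _ _ _ _ _ _ _ (hS x j s)).
  now autorewrite with index.
- apply (seq_phi _ _ _ _ _ _ _ (hS x j s)); lia.
Qed.

Lemma rho_shift x j s n : (NL + 1 <= n <= NR - 2)%Z ->
  frho (S x j s) n
  = frho s n
    - exp (u n x (j + 1)%Z - u (n + 1)%Z x (j + 2)%Z) * frho (S x j s) (n + 1)%Z.
Proof.
intros hn; destruct (Z.eq_dec n (NL + 1)) as [-> | ].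
- rewrite (seq_rho_left _ _ _ _ _ _ _ (hS x j s)).
  autorewrite with index; ring.
- rewrite (seq_rho _ _ _ _ _ _ _ (hS x j s) n) by lia; ring.
Qed.

Lemma rho_right_shift x j s :
  frho (S x j s) (NR - 1)%Z
  = frho s (NR - 1)%Z
    - exp (u (NR - 1)%Z x (j + 1)%Z - u NR x (j + 2)%Z)
      * (fAh s * fphi (S x j s) (NR - 1)%Z).
Proof.
rewrite (seq_rho_right _ _ _ _ _ _ _ (hS x j s)),
  (seq_Ah _ _ _ _ _ _ _ (hS x j s)); ring.
Qed.

Lemma phi_x x j s n : (NL + 1 <= n <= NR - 2)%Z ->
  fphi (V x j s) n = fphi s (n + 1)%Z - ddx u n x j * fphi s n.
Proof.
intros hn; destruct (Z.eq_dec n (NL + 1)) as [-> | ].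
- rewrite (xeq_phi_left _ _ _ _ _ _ _ (hV x j s)).
  now autorewrite with index.
- apply (xeq_phi _ _ _ _ _ _ _ (hV x j s)); lia.
Qed.

Lemma rho_x x j s n : (NL + 2 <= n <= NR - 1)%Z ->
  frho (V x j s) n = - frho s (n - 1)%Z + ddx u n x (j + 1) * frho s n.
Proof.
intros hn; destruct (Z.eq_dec n (NR - 1)) as [-> | ].
- rewrite (xeq_rho_right _ _ _ _ _ _ _ (hV x j s)).
  now autorewrite with index.
- apply (xeq_rho _ _ _ _ _ _ _ (hV x j s)); lia.
Qed.

Lemma A_x x j s : fA (V x j s) = - (A_rate NL u x j * fA s).
Proof.
pose proof (xeq_A _ _ _ _ _ _ _ (hV x j s)) as h; unfold A_rate; lra.
Qed.

Lemma Ah_x x j s : fAh (V x j s) = Ah_rate NR u x j * fAh s.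
Proof. exact (xeq_Ah _ _ _ _ _ _ _ (hV x j s)). Qed.

(** * Derivatives of the shifted unknowns along the x-flow *)

Notation flow x j s t := (state_line s (V x j s) t).

(** The shift fixes $A$, so the shifted value is affine in $t$ whatever $u$ is; commutation on $A$
    thus reduces to comparing its rates at $j$ and $j+1$. The same holds for $B,\hat A,\hat B$. *)
Lemma A_flow x j s :
  is_derive (fun t => fA (S (x + t) j (flow x j s t))) 0 (fA (V x j s)).
Proof.
apply (is_derive_ext (fun t => fA s + t * fA (V x j s))).
- intros t; now rewrite (seq_A _ _ _ _ _ _ _ (hS _ _ _)).
- apply is_derive_line.
Qed.

Lemma B_flow x j s :
  is_derive (fun t => fB (S (x + t) j (flow x j s t))) 0 (fB (V x j s)).
Proof.
apply (is_derive_ext (fun t => fB s + t * fB (V x j s))).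
- intros t; now rewrite (seq_B _ _ _ _ _ _ _ (hS _ _ _)).
- apply is_derive_line.
Qed.

Lemma Ah_flow x j s :
  is_derive (fun t => fAh (S (x + t) j (flow x j s t))) 0 (fAh (V x j s)).
Proof.
apply (is_derive_ext (fun t => fAh s + t * fAh (V x j s))).
- intros t; now rewrite (seq_Ah _ _ _ _ _ _ _ (hS _ _ _)).
- apply is_derive_line.
Qed.

Lemma Bh_flow x j s :
  is_derive (fun t => fBh (S (x + t) j (flow x j s t))) 0 (fBh (V x j s)).
Proof.
apply (is_derive_ext (fun t => fBh s + t * fBh (V x j s))).
- intros t; now rewrite (seq_Bh _ _ _ _ _ _ _ (hS _ _ _)).
- apply is_derive_line.
Qed.

Lemma is_derive_link n m x j k : (NL <= n <= NR)%Z -> (NL <= m <= NR)%Z ->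
  is_derive (fun t => exp (u n (x + t) j - u m (x + t) k)) 0
    ((ddx u n x j - ddx u m x k) * exp (u n x j - u m x k)).
Proof.
intros hn hm.
apply (is_derive_exp_minus (fun y => u n y j) (fun y => u m y k)); now apply hu.
Qed.

Definition defect n x j : R :=
  ddx u n x j - ddx u n x (j + 1)
  - (exp (u (n - 1)%Z x j - u n x (j + 1)%Z)
     - exp (u n x j - u (n + 1)%Z x (j + 1)%Z)).

(** No chain equation is assumed, so the formula serves both directions: the defect must vanish for
    commutation, and its vanishing suffices. *)
Lemma phi_flow n x j s : (NL + 1 <= n <= NR - 1)%Z ->
  fA s * fB s = -1 -> fAh s * fBh s = -1 ->
  is_derive (fun t => fphi (S (x + t) j (flow x j s t)) n) 0
    (fphi (V x (j + 1)%Z (S x j s)) n - defect n x j * fphi s n).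
Proof.
intros hn hAB hABh.
destruct (Z.eq_dec n (NL + 1)) as [-> | hL].
- apply (is_derive_ext (fun t =>
    (fA s + t * fA (V x j s))
      * (exp (u NL (x + t) j - u (NL + 1)%Z (x + t) (j + 1)%Z)
         * (frho s (NL + 1)%Z + t * frho (V x j s) (NL + 1)%Z))
    + (fphi s (NL + 1)%Z + t * fphi (V x j s) (NL + 1)%Z))).
  { intros t; rewrite (seq_phi_left _ _ _ _ _ _ _ (hS _ _ _)); cbn; ring. }
  evar_last.
  { apply is_derive_Rplus; [apply is_derive_Rmult; [| apply is_derive_Rmult] |].
    - apply is_derive_line.
    - apply is_derive_link; lia.
    - apply is_derive_line.
    - apply is_derive_line. }
  rewrite !phi_x, A_x, phi_shift by lia.
  rewrite (xeq_rho_left _ _ _ _ _ _ _ (hV x j s)),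
    (seq_phi_left _ _ _ _ _ _ _ (hS x j s)).
  unfold defect, A_rate; autorewrite with index; rewrite !Rplus_0_r.
  (* The rates of $A$, the exponential and $\rho^{N_L+1}$ add up to $-u^{N_L+1}_{1,x}$, and $AB=-1$
     turns the remaining $-AB\,e^{u^{N_L}-u^{N_L+1}_1}\phi^{N_L+1}$ into the interior term. *)
  ring [hAB].
- apply (is_derive_ext (fun t =>
    exp (u (n - 1)%Z (x + t) j - u n (x + t) (j + 1)%Z)
      * (fphi s (n - 1)%Z + t * fphi (V x j s) (n - 1)%Z)
    + (fphi s n + t * fphi (V x j s) n))).
  { intros t; now rewrite phi_shift by lia. }
  evar_last.
  { apply is_derive_Rplus; [apply is_derive_Rmult |].
    - apply is_derive_link; lia.
    - apply is_derive_line.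
    - apply is_derive_line. }
  rewrite (phi_x x j s (n - 1)%Z) by lia.
  rewrite !Rplus_0_r; unfold defect.
  destruct (Z.eq_dec n (NR - 1)) as [-> | hR].
  (* Since $\hat A\hat B=-1$, the term $\hat B\rho^{N_R-1}_1$ yields
     $e^{u^{N_R-1}_1-u^{N_R}_2}\phi^{N_R-1}_1$, which cancels the exponential in the equation for
     $\phi^{N_R-1}_x$ at $j+1$. *)
  + rewrite !(xeq_phi_right _ _ _ _ _ _ _ (hV _ _ _)).
    rewrite rho_right_shift, (seq_Bh _ _ _ _ _ _ _ (hS _ _ _)).
    rewrite phi_shift by lia.
    autorewrite with index; ring [hABh].
  + rewrite !phi_x, !phi_shift by lia.
    autorewrite with index; ring.
Qed.

Lemma defect_eq0 n x j : chain_at u n x j <-> defect n x j = 0.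
Proof. unfold chain_at, defect; lra. Qed.

(** The recursion for the shifted $\rho$ is differentiated term by term. It starts at $N_R-1$, where
    [phi_flow] supplies the derivative of $\phi^{N_R-1}_1$; below that, the derivative of
    $\rho^{n+1}_1$ is the induction hypothesis. *)
Lemma rho_flow n x j s :
  (forall m y k, (NL + 1 <= m <= NR - 1)%Z -> chain_at u m y k) ->
  (forall y k, Ah_rate NR u y (k + 1) = Ah_rate NR u y k) ->
  (NL + 1 <= n <= NR - 1)%Z -> fA s * fB s = -1 -> fAh s * fBh s = -1 ->
  is_derive (fun t => frho (S (x + t) j (flow x j s t)) n) 0
    (frho (V x (j + 1)%Z (S x j s)) n).
Proof.
intros hc hAh hn hAB hABh.
remember (Z.to_nat (NR - 1 - n)) as k eqn:hk.
revert n hn hk; induction k as [| k IH]; intros n hn hk.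
- replace n with (NR - 1)%Z by lia; clear n hn hk.
  assert (hphi := phi_flow (NR - 1) x j s ltac:(lia) hAB hABh).
  rewrite (proj1 (defect_eq0 _ _ _) (hc (NR - 1)%Z x j ltac:(lia))) in hphi.
  apply (is_derive_ext (fun t =>
    (frho s (NR - 1)%Z + t * frho (V x j s) (NR - 1)%Z)
    - exp (u (NR - 1)%Z (x + t) (j + 1)%Z - u NR (x + t) (j + 2)%Z)
      * ((fAh s + t * fAh (V x j s))
         * fphi (S (x + t) j (flow x j s t)) (NR - 1)%Z))).
  { intros t; now rewrite rho_right_shift. }
  evar_last.
  { apply is_derive_Rminus; [| apply is_derive_Rmult; [| apply is_derive_Rmult]].
    - apply is_derive_line.
    - apply is_derive_link; lia.
    - apply is_derive_line.
    - exact hphi. }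
  cbv beta; rewrite state_line_0, !Rplus_0_r, Ah_x, !rho_x by lia.
  replace (NR - 1 - 1)%Z with (NR - 2)%Z by lia.
  rewrite (rho_shift x j s (NR - 2)%Z) by lia.
  rewrite (xeq_phi_right _ _ _ _ _ _ _ (hV x (j + 1)%Z (S x j s))).
  rewrite (seq_Bh _ _ _ _ _ _ _ (hS x j s)).
  (* The exponential in the shift equation involves $u^{N_R}_2$; moving the rate of $\hat A$ to
     $j+2$ makes the two $u^{N_R}_{2,x}$ cancel. *)
  replace (Ah_rate NR u x j) with (Ah_rate NR u x (j + 1 + 1))
    by (rewrite !hAh; reflexivity).
  pose proof (hc (NR - 1)%Z x (j + 1)%Z ltac:(lia)) as h.
  unfold chain_at in h; unfold Ah_rate.
  autorewrite with index in *.
  assert (h' : ddx u (NR - 1) x (j + 1) = ddx u (NR - 1) x (j + 2)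
    + (exp (u (NR - 2)%Z x (j + 1)%Z - u (NR - 1)%Z x (j + 2)%Z)
       - exp (u (NR - 1)%Z x (j + 1)%Z - u NR x (j + 2)%Z))) by lra.
  rewrite h', rho_right_shift.
  ring [hABh].
- assert (hrho := IH (n + 1)%Z ltac:(lia) ltac:(lia)); clear IH.
  apply (is_derive_ext (fun t =>
    (frho s n + t * frho (V x j s) n)
    - exp (u n (x + t) (j + 1)%Z - u (n + 1)%Z (x + t) (j + 2)%Z)
      * frho (S (x + t) j (flow x j s t)) (n + 1)%Z)).
  { intros t; now rewrite (rho_shift _ _ _ n) by lia. }
  evar_last.
  { apply is_derive_Rminus; [| apply is_derive_Rmult].
    - apply is_derive_line.
    - apply is_derive_link; lia.
    - exact hrho. }
  cbv beta; rewrite state_line_0, !Rplus_0_r.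
  rewrite (rho_x x (j + 1)%Z (S x j s) (n + 1)%Z) by lia.
  pose proof (hc n x (j + 1)%Z ltac:(lia)) as h; unfold chain_at in h.
  autorewrite with index in *.
  pose proof (rho_shift x j s n ltac:(lia)) as hr.
  set (r := frho (S x j s) (n + 1)%Z) in *.
  assert (h' : ddx u n x (j + 1) = ddx u n x (j + 2)
    + (exp (u (n - 1)%Z x (j + 1)%Z - u n x (j + 2)%Z)
       - exp (u n x (j + 1)%Z - u (n + 1)%Z x (j + 2)%Z))) by lra.
  destruct (Z.eq_dec n (NL + 1)) as [-> | hL].
  + rewrite !(xeq_rho_left _ _ _ _ _ _ _ (hV _ _ _)).
    rewrite (seq_B _ _ _ _ _ _ _ (hS _ _ _)),
      (seq_phi_left _ _ _ _ _ _ _ (hS _ _ _)).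
    autorewrite with index in *.
    (* Here $-B\phi^{N_L+1}_1$ contains $-AB\,e^{u^{N_L}-u^{N_L+1}_1}\rho^{N_L+1}$, which by $AB=-1$
       matches the exponential term of $\rho^{N_L+1}_x$ at $j$. *)
    rewrite h', hr; ring [hAB].
  + rewrite !rho_x by lia.
    rewrite (rho_shift x j s (n - 1)%Z) by lia.
    autorewrite with index in *.
    rewrite h', hr; ring.
Qed.

(** In the sum of the end equation and the chain equation $n=N_L+1$ at $(x,j)$ the terms
    $e^{u^{N_L}-u^{N_L+1}_1}$ cancel, leaving the invariance of the rate of $B$. *)
Lemma B_rate_invariant x j s :
  chain_at u (NL + 1) x j -> left_equation NL u ->
  fB (V x (j + 1)%Z (S x j s)) = fB (V x j s).
Proof.
intros h hl; specialize (hl x j); unfold chain_at in h.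
rewrite !(xeq_B _ _ _ _ _ _ _ (hV _ _ _)), (seq_B _ _ _ _ _ _ _ (hS _ _ _)).
autorewrite with index in *; f_equal; lra.
Qed.

Lemma Bh_rate_invariant x j s :
  chain_at u (NR - 1) x j -> right_equation NR u ->
  fBh (V x (j + 1)%Z (S x j s)) = fBh (V x j s).
Proof.
intros h hr; specialize (hr x j); unfold chain_at in h.
rewrite !(xeq_Bh _ _ _ _ _ _ _ (hV _ _ _)), (seq_Bh _ _ _ _ _ _ _ (hS _ _ _)).
autorewrite with index in *; f_equal; lra.
Qed.

End Flow.

Theorem theorem4 (NL NR : Z) (u : lattice_field)
  (hN : (NR - NL >= 3)%Z)
  (hu : forall (n : Z) (x : R) (j : Z), (NL <= n <= NR)%Z ->
          ex_derive (fun y => u n y j) x) :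
  reduced_chain NL NR u <-> compatible NL NR u.
Proof.
rewrite reduced_chainE by exact hN; split.
- intros (hc & hl & hr) V S hV hS.
  pose proof (proj1 (left_equation_iff NL u
    (fun x j => hc (NL + 1)%Z x j ltac:(lia))) hl) as hA.
  pose proof (proj1 (right_equation_iff NR u
    (fun x j => hc (NR - 1)%Z x j ltac:(lia))) hr) as hAh.
  split; [| split; [| split; [| split]]].
  + apply commute_on_linear; [reflexivity |]; intros x j s _ _.
    rewrite (A_x NL NR u V hV), hA, (seq_A _ _ _ _ _ _ _ (hS x j s)).
    rewrite <- (A_x NL NR u V hV); apply (A_flow NL NR u V S hS).
  + apply commute_on_linear; [reflexivity |]; intros x j s _ _.
    rewrite (B_rate_invariant NL NR u V S hV hS) by (assumption || apply hc; lia).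
    apply (B_flow NL NR u V S hS).
  + apply commute_on_linear; [reflexivity |]; intros x j s _ _.
    rewrite (Ah_x NL NR u V hV), hAh, (seq_Ah _ _ _ _ _ _ _ (hS x j s)).
    rewrite <- (Ah_x NL NR u V hV); apply (Ah_flow NL NR u V S hS).
  + apply commute_on_linear; [reflexivity |]; intros x j s _ _.
    rewrite (Bh_rate_invariant NL NR u V S hV hS) by (assumption || apply hc; lia).
    apply (Bh_flow NL NR u V S hS).
  + intros n hn; split; apply commute_on_linear; try reflexivity;
      intros x j s hAB hABh.
    * pose proof (phi_flow NL NR u hN hu V S hV hS n x j s hn hAB hABh) as h.
      rewrite (proj1 (defect_eq0 u n x j) (hc n x j hn)) in h.
      now rewrite Rmult_0_l, Rminus_0_r in h.
    * now apply (rho_flow NL NR u hN hu V S hV hS).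
- intros hcomp.
  (* [compatible] quantifies over all solutions [V] and [S], so the converse needs an actual
     pair. *)
  destruct (x_equations_solvable NL NR u ltac:(lia)) as [V hV].
  destruct (shift_equations_solvable NL NR u ltac:(lia)) as [S hS].
  destruct (hcomp V S hV hS) as (hA & _ & hAh & _ & hphi); clear hcomp.
  (* This state meets both normalisations, and its unit values of $A$, $\hat A$ and $\phi^n$ let the
     rates and the defects be read off directly. *)
  pose (s := State 1 (-1) 1 (-1) (fun _ => 1) (fun _ => 0)).
  assert (hAB : fA s * fB s = -1) by (cbn; ring).
  assert (hABh : fAh s * fBh s = -1) by (cbn; ring).
  assert (hc : forall n x j, (NL + 1 <= n <= NR - 1)%Z -> chain_at u n x j).
  { intros n x j hn; apply defect_eq0.
    pose proof (phi_flow NL NR u hN hu V S hV hS n x j s hn hAB hABh) as h.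
    pose proof (proj1 (commute_on_linear V S (fun s => fphi s n)
      (fun _ _ _ => eq_refl)) (proj1 (hphi n hn)) x j s hAB hABh) as h'.
    (* The same function of $t$ has its derivative computed with and without the defect term. *)
    apply is_derive_unique in h, h'; rewrite h in h'; cbn in h'; lra. }
  split; [exact hc | split].
  + apply left_equation_iff; [intros; apply hc; lia |]; intros x j.
    pose proof (proj1 (commute_on_linear V S fA (fun _ _ _ => eq_refl))
      hA x j s hAB hABh) as h'.
    pose proof (A_flow NL NR u V S hS x j s) as h.
    apply is_derive_unique in h, h'; rewrite h in h'.
    rewrite !(A_x NL NR u V hV), (seq_A _ _ _ _ _ _ _ (hS x j s)) in h'.
    cbn in h'; lra.
  + apply right_equation_iff; [intros; apply hc; lia |]; intros x j.
    pose proof (proj1 (commute_on_linear V S fAh (fun _ _ _ => eq_refl))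
      hAh x j s hAB hABh) as h'.
    pose proof (Ah_flow NL NR u V S hS x j s) as h.
    apply is_derive_unique in h, h'; rewrite h in h'.
    rewrite !(Ah_x NL NR u V hV), (seq_Ah _ _ _ _ _ _ _ (hS x j s)) in h'.
    cbn in h'; lra.
Qed.
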